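(* Assume the baseline output function $T$ is strictly convex. Then the family of $w$-threshold policies $\{r_p^* : p\in[0,1]\}$ traces out the complete Pareto frontier between mean customer waiting time $\mathbb{E}[W_q]$ and baseline throughput $\mathcal{T}$: every $w$-threshold policy $r_p^*$ is Pareto optimal, and every point of the Pareto frontier (every pair $(\mathbb{E}[W_q],\mathcal{T})$ attained by a Pareto optimal routing policy) is attained by $r_p^*$ for some $p\in[0,1]$.
   Context: Queueing model. Fix $\lambda,\mu>0$ with $\rho=\lambda/\mu<1$. There are two identical first-come-first-served servers with unlimited queues. Customers arrive in pairs according to a Poisson process of rate $\lambda$; the service times $X_1,X_2$ of a pair are i.i.d. $\mathrm{Exp}(\mu)$, independent across pairs. A routing policy is a measurable $r:\mathbb{R}_+^2\to[0,1]$: a pair with service times $(x_1,x_2)$ is split (one customer to each server) with probability $r(x_1,x_2)$ and otherwise bunched (both to the same server). Server assignment is load-balanced: when splitting, each server is equally likely to receive either customer; when bunching, the destination server is uniformly random, and a uniformly random one of the two customers goes first. The splitting probability of $r$ is $p=\mathbb{E}[r(X_1,X_2)]$. Waiting time. Each server is an $M^X/G/1$ queue with batch arrival rate $\Lambda=\lambda(1+p)/2$, utilization $\rho$, and batch workload $B_s$ satisfying $\Lambda\mathbb{E}[B_s^2]=\frac{\lambda}{2}\mathbb{E}[(1-r)(X_1+X_2)^2+r(X_1^2+X_2^2)]$ (with $r=r(X_1,X_2)$). The mean customer waiting time in queue is the sum of the Pollaczek--Khinchine mean virtual wait and the mean within-batch delay: $\mathbb{E}[W_q]=\frac{\Lambda\mathbb{E}[B_s^2]}{2(1-\rho)}+\frac14\mathbb{E}[(1-r)(X_1+X_2)]$.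 Baseline throughput. A server with no customers works on a baseline task; $T(t)$ is the output of an uninterrupted period of length $t$, where $T$ is differentiable, increasing, $T(0)=0$. The long-run average baseline throughput per server is $\mathcal{T}=\mathcal{T}(p)=\mathbb{E}[T(I)]/\mathbb{E}[I+B]$, where the idle period $I\sim\mathrm{Exp}(\Lambda)$ and the busy period $B$ has mean $\mathbb{E}[B]=\rho/(\Lambda(1-\rho))$. Splitting benefit: $w(x_1,x_2)=c_1x_1x_2+c_2(x_1+x_2)$, $c_1=\frac{\lambda}{2(1-\rho)}$, $c_2=\frac14$. The $w$-threshold policy $r_p^*$ splits when $w(x_1,x_2)>\tau_p$ and bunches when $w(x_1,x_2)<\tau_p$, where $\tau_p$ is chosen so that $\Pr[w(X_1,X_2)>\tau_p]=p$ ($\tau=0$ for $p=1$, $\tau=\infty$ for $p=0$). Pareto optimality: a routing policy is Pareto optimal if no other routing policy strictly improves one objective (decreases $\mathbb{E}[W_q]$ or increases $\mathcal{T}$) without worsening the other.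
   Formalization: The formal theorem additionally assumes that E[T(I)] is finite for every splitting probability p in [0,1]; otherwise the throughput can be infinite for a range of small p (e.g. T(t)=exp(at)-1, λ/2<a<λ) and those threshold policies are not Pareto optimal. *)

(* Defs.v *)
(* MathComp / MathComp-Analysis *)
From HB Require Import structures.
From mathcomp Require Import all_boot all_order all_algebra.
From mathcomp Require Import all_classical all_reals all_analysis.

Set Implicit Arguments.
Unset Strict Implicit.
Unset Printing Implicit Defensive.

Import Order.TTheory GRing.Theory Num.Theory.
Import numFieldNormedType.Exports.

Local Open Scope classical_set_scope.
Local Open Scope ring_scope.

Definition nonneg_quadrant {R : realType} : set (R * R) :=
  [set x | 0 <= x.1 /\ 0 <= x.2].

(* A map R_+^2 -> [0,1] is encoded by a total function that is constrained,
   and used, only on the quadrant. *)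
Definition routing_policy (R : realType) (r : R * R -> R) : Prop :=
  measurable_fun nonneg_quadrant r /\
  (forall x, nonneg_quadrant x -> 0 <= r x <= 1).

(* The service times take values in R_+ surely, so that r (X1, X2) is always
   an evaluation of r inside its domain. *)
Definition iid_exponential (R : realType) (d : measure_display)
    (Omega : measurableType d) (P : probability Omega R)
    (mu : R) (X1 X2 : {RV P >-> R}) : Prop :=
  [/\ forall om, 0 <= X1 om /\ 0 <= X2 om,
      forall A : set R, measurable A ->
        distribution P X1 A = exponential_prob mu A,
      forall A : set R, measurable A ->
        distribution P X2 A = exponential_prob mu A &
      forall A B : set R, measurable A -> measurable B ->
        P (X1 @^-1` A `&` X2 @^-1` B) =
          (P (X1 @^-1` A) * P (X2 @^-1` B))%E].

Section model.
Context {R : realType}.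
Variables lam mu : R.

Definition utilization : R := lam / mu.

Definition batch_rate (p : R) : R := lam * (1 + p) / 2.

Definition c1 : R := lam / (2 * (1 - utilization)).
Definition c2 : R := 1 / 4.

Definition splitting_benefit (x1 x2 : R) : R := c1 * x1 * x2 + c2 * (x1 + x2).

Section throughput.
Variable T : R -> R.

(* E[f(I)] for I ~ Exp(rate) *)
Definition idle_expectation (rate : R) (f : R -> R) : R :=
  \int[lebesgue_measure]_(t in `[0, +oo[) (f t * exponential_pdf rate t).

Definition mean_busy_period (p : R) : R :=
  utilization / (batch_rate p * (1 - utilization)).

(* E[T(I)] / (E[I] + E[B]) *)
Definition throughput_at (p : R) : R :=
  idle_expectation (batch_rate p) T /
  (idle_expectation (batch_rate p) id + mean_busy_period p).

(* E[T(I)] is finite for every splitting probability. *)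
Definition finite_idle_output : Prop :=
  forall p : R, 0 <= p <= 1 ->
    lebesgue_measure.-integrable `[0, +oo[
      (fun t : R => (T t * exponential_pdf (batch_rate p) t)%:E).

End throughput.

Section objectives.
Context {d : measure_display} {Omega : measurableType d}
  (P : probability Omega R).
Variables X1 X2 : Omega -> R.

Definition splitting_probability (r : R * R -> R) : R :=
  fine 'E_P[fun om => r (X1 om, X2 om)].

(* Lambda * E[B_s^2]: a bunched pair brings X1 + X2 to one server, a split pair
   brings X1 to one server and X2 to the other. *)
Definition rate_batch_second_moment (r : R * R -> R) : R :=
  lam / 2 *
  fine 'E_P[fun om =>
    (1 - r (X1 om, X2 om)) * (X1 om + X2 om) ^+ 2
    + r (X1 om, X2 om) * (X1 om ^+ 2 + X2 om ^+ 2)].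

Definition mean_wait (r : R * R -> R) : R :=
  rate_batch_second_moment r / (2 * (1 - utilization))
  + 1 / 4 * fine 'E_P[fun om => (1 - r (X1 om, X2 om)) * (X1 om + X2 om)].

Definition throughput (T : R -> R) (r : R * R -> R) : R :=
  throughput_at T (splitting_probability r).

Definition pareto_optimal (T : R -> R) (r : R * R -> R) : Prop :=
  routing_policy r /\
  ~ (exists r', routing_policy r' /\
       ((mean_wait r' < mean_wait r /\ throughput T r <= throughput T r') \/
        (throughput T r < throughput T r' /\ mean_wait r' <= mean_wait r))).

(* [r] is a version of r_p^*; its values on the boundary w = tau are free. *)
Definition threshold_policy (p : R) (r : R * R -> R) : Prop :=
  routing_policy r /\
  exists tau : \bar R,
    [/\ P [set om | (tau < (splitting_benefit (X1 om) (X2 om))%:E)%E] = p%:E,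
        p = 1 -> tau = 0%E,
        p = 0 -> tau = +oo%E &
        forall x1 x2 : R, 0 <= x1 -> 0 <= x2 ->
          ((tau < (splitting_benefit x1 x2)%:E)%E -> r (x1, x2) = 1) /\
          (((splitting_benefit x1 x2)%:E < tau)%E -> r (x1, x2) = 0)].

End objectives.
End model.

(* One-sided at the endpoint 0. *)
Definition differentiable_on_nonneg (R : realType) (T : R -> R) : Prop :=
  (forall t : R, 0 < t -> derivable T t 1) /\
  cvg (((T h - T 0) / h) @[h --> (0 : R)^'+]).

Definition increasing_on_nonneg (R : realType) (T : R -> R) : Prop :=
  forall s t : R, 0 <= s -> s <= t -> T s <= T t.

Definition strictly_convex_on_nonneg (R : realType) (T : R -> R) : Prop :=
  forall s t a : R, 0 <= s -> 0 <= t -> s != t -> 0 < a < 1 ->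
    T (a * s + (1 - a) * t) < a * T s + (1 - a) * T t.

(* Main.v *)
(* The mean wait is an affine decreasing function of [E[r w]], where [w] is the
   splitting benefit, and the throughput depends on [r] only through the
   splitting probability [p]. Strict convexity of [T] makes [T t / t] increasing,
   so the throughput is strictly decreasing in [p]; and by a Neyman-Pearson
   argument the threshold policy maximizes [E[r w]] among the policies with
   splitting probability at most [p], strictly so below [p]. Thresholds exist for
   every [p], and the boundary [w = tau] does not matter, because the law of [w]
   has no atoms. *)
Require Import Defs.
From HB Require Import structures.
From mathcomp Require Import all_boot all_order all_algebra.
From mathcomp Require Import all_classical all_reals all_analysis.
From mathcomp Require Import measurable_realfun ring lra.

Set Implicit Arguments.
Unset Strict Implicit.
Unset Printing Implicit Defensive.

Import Order.TTheory GRing.Theory Num.Theory.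
Import numFieldNormedType.Exports.
Local Open Scope classical_set_scope.
Local Open Scope ring_scope.

(** * Vanishing integrals and integration against a density *)

Lemma ae_eq_Rintegral0 d (T : measurableType d) (R : realType)
    (mu : {measure set T -> \bar R}) (D : set T) (f : T -> R) :
  measurable D -> mu.-integrable D (EFin \o f) ->
  (forall x, D x -> 0 <= f x) -> \int[mu]_(x in D) f x = 0 ->
  ae_eq mu D (EFin \o f) (cst 0%E).
Proof.
move=> mD fi f0 If; apply/(ae_eq_integral_abs mu mD); first exact: measurable_int fi.
under eq_integral => x /set_mem Dx do rewrite /= ger0_norm ?f0//.
by rewrite -[LHS]fineK ?integrable_fin_num// -[fine _]/(Rintegral _ _ _) If.
Qed.

(** If the integral were 0, [f] would vanish a.e. on [D], and [A] would lie in a null set. This is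
    the source of strictness in the comparison of throughputs. *)
Lemma Rintegral_gt0 d (T : measurableType d) (R : realType)
    (mu : {measure set T -> \bar R}) (D A : set T) (f : T -> R) :
  measurable D -> mu.-integrable D (EFin \o f) ->
  (forall x, D x -> 0 <= f x) ->
  measurable A -> (0 < mu A)%E -> A `<=` D -> (forall x, A x -> f x != 0) ->
  0 < \int[mu]_(x in D) f x.
Proof.
move=> mD fi f0 mA muA AD fA; rewrite lt_neqAle Rintegral_ge0// andbT eq_sym.
apply/eqP => If; have [N [mN N0 fN]] := ae_eq_Rintegral0 mD fi f0 If.
move: muA; rewrite (@subset_measure0 _ _ _ mu A N) ?ltxx//.
move=> x Ax; apply: fN => /= /(_ (AD _ Ax)) [] /eqP.
by apply/negP; exact: fA.
Qed.

(** The density [f] has the same integral over every measurable set as the Radon-Nikodym derivative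
    of [nu], so the two agree a.e. and the change of variables for the derivative carries over to
    [f]. *)
Lemma ge0_integral_density d (T : measurableType d) (R : realType)
    (nu : {finite_measure set T -> \bar R})
    (mu : {sigma_finite_measure set T -> \bar R}) (f : T -> \bar R) :
  measurable_fun setT f ->
  (forall A, measurable A -> nu A = \int[mu]_(x in A) f x)%E ->
  forall g, measurable_fun setT g -> (forall x, 0 <= g x)%E ->
  (\int[nu]_x g x = \int[mu]_x (g x * f x))%E.
Proof.
move=> mf nuE g mg g0.
have numu : nu `<< mu.
  apply/null_content_dominatesP => A mA muA0.
  by rewrite nuE// null_set_integral//; exact: measurable_funTS.
rewrite -(Radon_Nikodym_SigmaFinite.change_of_variables numu g0 measurableT mg).
have fi := Radon_Nikodym_SigmaFinite.f_integrable numu.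
apply: ae_eq_integral => //.
- by apply: emeasurable_funM => //; exact: measurable_int fi.
- exact: emeasurable_funM.
- apply: ae_eqe_mul2l; apply: integral_ae_eq => // A _ mA.
  by rewrite -nuE// (Radon_Nikodym_SigmaFinite.f_integral numu mA).
Qed.

(** * Exponential moments *)

Lemma integral_exponential_mean (R : realType) (b : R) : 0 < b ->
  (\int[lebesgue_measure]_(t in `[0%R, +oo[) (t * exponential_pdf b t)%:E =
   (b^-1)%:E)%E.
Proof.
move=> b0.
pose f (t : R) := t * (b * expR (- b * t)).
(* Antiderivative of [f] from integration by parts; it tends to 0 at infinity and [F 0] is
   [- b^-1]. *)
pose F (t : R) := - ((t + b^-1) * expR (- b * t)).
have dF (t : R) : is_derive t (1 : R) F (f t).
  rewrite /F /f; apply: is_derive_eq.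
  by rewrite /GRing.scale/= ; field; rewrite gt_eqF.
have cF : continuous F.
  by move=> t; apply: differentiable_continuous; apply/derivable1_diffP.
transitivity (\int[lebesgue_measure]_(t in `[0%R, +oo[) (f t)%:E)%E.
  apply: eq_integral => t; rewrite inE/= in_itv/= andbT => t0.
  by rewrite exponential_pdfE.
have cf : continuous f.
  move=> t; apply: differentiable_continuous; apply/derivable1_diffP.
  by rewrite /f; exact: ex_derive.
rewrite (@ge0_continuous_FTC2y _ f F _ 0).
- by rewrite -EFinB /F mulr0 expR0 add0r mulr1 opprK add0r.
- by move=> t t0; rewrite /f !mulr_ge0 ?expR_ge0// ltW.
- exact: continuous_subspaceT.
(* Half of the exponential decay absorbs the linear factor: [expR (b / 2 * t) >= 1 + b / 2 * t]
   gives [t + b^-1 <= (2 / b) * expR (b / 2 * t)]. *)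
- have cvg0 : (2 / b) * expR (- (b / 2 * t)) @[t --> +oo] --> (2 / b) * 0.
    apply: cvgMr.
    apply: (@cvg_comp _ _ _ (fun t => b / 2 * t) (fun t => expR (- t)) _
      (pinfty_nbhs R)); last exact: cvgr_expR.
    by have b2 : 0 < b / 2 by [rewrite divr_gt0]; exact: gt0_cvgMry.
  rewrite -oppr0; apply: cvgN; rewrite mulr0 in cvg0.
  apply: squeeze_cvgr cvg0; last exact: cvg_cst.
  near=> t; have t0 : 0 <= t by near: t; exact: nbhs_pinfty_ge.
  rewrite mulr_ge0 ?expR_ge0 ?addr_ge0 ?invr_ge0 ?(ltW b0)//=.
  have -> : expR (- b * t) = expR (- (b / 2 * t)) * expR (- (b / 2 * t)).
    by rewrite -expRD; congr expR; field.
  rewrite mulrA ler_pM2r ?expR_gt0// expRN ler_pdivrMr ?expR_gt0//.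
  apply: le_trans (ler_wpM2l _ (expR_ge1Dx _)); last by rewrite divr_ge0// ltW.
  have b1 : 0 < b^-1 by rewrite invr_gt0.
  have -> : 2 / b * (1 + b / 2 * t) = 2 * b^-1 + t by field; rewrite gt_eqF.
  lra.
- by move=> t _; exact: ex_derive.
- by apply: cvg_at_right_filter; exact: cF.
- by move=> t _; rewrite derive1E derive_val.
Unshelve. all: by end_near. Qed.

Lemma ae_eq_Rintegral d (T : measurableType d) (R : realType)
    (mu : {measure set T -> \bar R}) (D : set T) (f g : T -> R) :
  measurable D -> measurable_fun D f -> measurable_fun D g ->
  ae_eq mu D f g -> \int[mu]_(x in D) f x = \int[mu]_(x in D) g x.
Proof.
move=> mD mf mg fg; congr fine; apply: ae_eq_integral => //.
- exact/measurable_EFinP.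
- exact/measurable_EFinP.
- by apply: filterS fg => x /= + Dx => /(_ Dx) ->.
Qed.

Lemma integrable_exponential_sqr d (Omega : measurableType d) (R : realType)
    (P : probability Omega R) (mu : R) (X : {RV P >-> R}) : 0 < mu ->
  (forall A : set R, measurable A ->
     distribution P X A = exponential_prob mu A) ->
  P.-integrable setT (fun om => (X om ^+ 2)%:E).
Proof.
move=> mu0 XE; apply/integrableP; split.
  by apply/measurable_EFinP; exact: measurable_funX.
under eq_integral do rewrite /= ger0_norm ?sqr_ge0//.
have msq : measurable_fun setT (fun x : measurableTypeR R => (x ^+ 2)%:E).
  by apply/measurable_EFinP; exact: measurable_funX.
(* [lebesgue_measure] lives on [measurableTypeR R], which has the same measurable
   sets as [R] but another display. *)
have mX' : measurable_fun setT (X : Omega -> measurableTypeR R).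
  exact: measurable_funPT X.
pose X' : {mfun Omega >-> measurableTypeR R} :=
  HB.pack (X : Omega -> measurableTypeR R) (isMeasurableFun.Build _ _ _ _ _ mX').
have -> : (\int[P]_om (X om ^+ 2)%:E = \int[distribution P X']_x (x ^+ 2)%:E)%E.
  by rewrite ge0_integral_distribution// => y; rewrite lee_fin sqr_ge0.
have mpdf r : measurable_fun setT
    (fun x : measurableTypeR R => (exponential_pdf r x)%:E).
  by apply/measurable_EFinP; exact: measurable_exponential_pdf.
rewrite (ge0_integral_density (mu := lebesgue_measure) (mpdf mu))//; last first.
  by move=> x; rewrite lee_fin sqr_ge0.
(* [C] is chosen so that [x ^+ 2] times the density of rate [mu] is at most [C] times the density of
   rate [mu / 2]. Squaring [mu / 4 * x <= expR (mu / 4 * x)] gives the factor [16 / mu ^+ 2], and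
   passing from [mu] to [mu / 2] in front of the exponential doubles it. *)
pose C := 32 / mu ^+ 2.
have C0 : 0 <= C by rewrite divr_ge0 ?exprn_ge0// ltW.
have mu2 : 0 < mu / 2 by rewrite divr_gt0.
apply: (@le_lt_trans _ _
    (\int[lebesgue_measure]_x (C%:E * (exponential_pdf (mu / 2) x)%:E))%E).
  apply: ge0_le_integral => //.
  - by move=> x _; rewrite lee_fin mulr_ge0 ?sqr_ge0// exponential_pdf_ge0// ltW.
  - exact: emeasurable_funM.
  - by apply: emeasurable_funM.
  move=> x _; rewrite -!EFinM lee_fin.
  have [x0|x0] := ltP x 0; first by rewrite !lt0_exponential_pdf// !mulr0.
  rewrite !exponential_pdfE//.
  pose e := expR (mu / 4 * x).
  have xe : mu / 4 * x <= e.
    by rewrite (le_trans _ (expR_ge1Dx _))// ler_wpDl.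
  have -> : expR (- (mu / 2) * x) = e ^+ 2 * expR (- mu * x).
    by rewrite /e expr2 -!expRD; congr expR; field.
  rewrite !mulrA ler_pM2r ?expR_gt0//.
  have -> : x ^+ 2 * mu = (mu / 4 * x) ^+ 2 * (16 / mu).
    by field; rewrite gt_eqF.
  have -> : C * mu / 2 * e * e = e ^+ 2 * (16 / mu).
    by rewrite /C; field; rewrite gt_eqF.
  rewrite ler_pM2r ?divr_gt0// ler_pXn2r ?nnegrE ?expR_ge0//.
  by rewrite mulr_ge0// divr_ge0// ltW.
rewrite ge0_integralZl//; last first.
  by move=> x _; rewrite lee_fin exponential_pdf_ge0// ltW.
by rewrite integral_exponential_pdf// mule1 ltry.
Qed.

(** * Throughput *)

(** This is the strict growth of [T t / t], cross-multiplied: [s] is the convex combination of [t]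
    and 0 with weight [s / t], and [T 0 = 0]. *)
Lemma strictly_convex_chord (R : realType) (T : R -> R) (s t : R) :
  strictly_convex_on_nonneg T -> T 0 = 0 -> 0 < s -> s < t ->
  T s * t < T t * s.
Proof.
move=> cT T0 s0 st; have t0 := lt_trans s0 st.
have st1 : 0 < s / t < 1 by rewrite divr_gt0// ltr_pdivrMr// mul1r.
have := cT t 0 (s / t) (ltW t0) (lexx _) (lt0r_neq0 t0) st1.
rewrite T0 !mulr0 !addr0 divfK ?gt_eqF// => Ts.
by rewrite -ltr_pdivlMr// (_ : T t * s / t = s / t * T t)//; ring.
Qed.

Lemma idle_expectation_id (R : realType) (b : R) : 0 < b ->
  idle_expectation b id = b^-1.
Proof. by move=> b0; exact (congr1 (@fine R) (integral_exponential_mean b0)). Qed.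

Lemma integrable_exponential_mean (R : realType) (b : R) : 0 < b ->
  lebesgue_measure.-integrable `[0, +oo[
    (fun t : R => (t * exponential_pdf b t)%:E).
Proof.
move=> b0; apply/integrableP; split.
  apply/measurable_EFinP/measurable_funM => //.
  by apply: measurable_funTS; exact: measurable_exponential_pdf.
rewrite [ltLHS](_ : _ = (b^-1)%:E) ?ltry// -(integral_exponential_mean b0).
apply: eq_integral => t; rewrite inE/= in_itv/= andbT => t0.
by rewrite ger0_norm// mulr_ge0// exponential_pdf_ge0// ltW.
Qed.

(* Both sides are averages of [T t / t] against the Gamma(2) densities
   [rate ^+ 2 * t * expR (- rate * t)], whose difference changes sign exactly
   once, at [t0]; subtracting the chord of [T] through [t0] does not change the
   difference of the averages and makes the integrand nonnegative. *)
Lemma idle_output_decreasing (R : realType) (T : R -> R) (a b : R) :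
  strictly_convex_on_nonneg T -> T 0 = 0 -> 0 < a -> a < b ->
  lebesgue_measure.-integrable `[0, +oo[
    (fun t : R => (T t * exponential_pdf a t)%:E) ->
  lebesgue_measure.-integrable `[0, +oo[
    (fun t : R => (T t * exponential_pdf b t)%:E) ->
  b * idle_expectation b T < a * idle_expectation a T.
Proof.
move=> cT T0 a0 ab iTa iTb; have b0 := lt_trans a0 ab.
have ba0 : 0 < b - a by rewrite subr_gt0.
(* The positive time at which the two Gamma(2) densities cross, that is, the solution of [a ^+ 2 *
   expR (- a * t) = b ^+ 2 * expR (- b * t)]. *)
pose t0 := ln ((b / a) ^+ 2) / (b - a).
have bDa1 : 1 < (b / a) ^+ 2 by rewrite exprn_egt1// ltr_pdivlMr// mul1r.
have t0_gt0 : 0 < t0 by rewrite divr_gt0// ln_gt0.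
have et0 : a ^+ 2 * expR ((b - a) * t0) = b ^+ 2.
  rewrite (_ : (b - a) * t0 = ln ((b / a) ^+ 2)); last first.
    by rewrite mulrC divfK// gt_eqF.
  rewrite lnK ?posrE; last exact: lt_trans bDa1.
  by field; rewrite gt_eqF.
pose k (t : R) := a * exponential_pdf a t - b * exponential_pdf b t.
have kE t : 0 <= t ->
    k t = expR (- b * t) * (a ^+ 2 * (expR ((b - a) * t) - expR ((b - a) * t0))).
  move=> t_ge0; rewrite /k !exponential_pdfE// mulrBr et0.
  rewrite [expR (- a * t)](_ : _ = expR (- b * t) * expR ((b - a) * t)).
    by ring.
  by rewrite -expRD; congr expR; ring.
have k_lt0 t : 0 <= t -> t < t0 -> k t < 0.
  move=> t_ge0 tt0; rewrite kE// pmulr_rlt0 ?expR_gt0// pmulr_rlt0 ?exprn_gt0//.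
  by rewrite subr_lt0 ltr_expR ltr_pM2l.
have k_gt0 t : t0 < t -> 0 < k t.
  move=> t0t; rewrite kE ?(ltW (lt_trans t0_gt0 t0t))//.
  rewrite pmulr_rgt0 ?expR_gt0// pmulr_rgt0 ?exprn_gt0//.
  by rewrite subr_gt0 ltr_expR ltr_pM2l.
pose g := T t0 / t0.
pose h (t : R) := (T t - g * t) * k t.
have h_gt0 t : t0 < t -> 0 < h t.
  move=> t0t; rewrite /h mulr_gt0 ?k_gt0// subr_gt0 /g mulrAC ltr_pdivrMr//.
  exact: strictly_convex_chord.
have h_ge0 t : `[0, +oo[%classic t -> 0 <= h t.
  rewrite /= in_itv/= andbT => t_ge0.
  have [tt0|t0t|->] := ltgtP t t0; last 2 first.
  - by rewrite ltW// h_gt0.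
  - by rewrite /h /g divfK ?subrr ?mul0r// gt_eqF.
  move: t_ge0; rewrite le_eqVlt => /predU1P[<-|t_gt0].
    by rewrite /h T0 mulr0 subrr mul0r.
  rewrite /h mulr_le0// ?(ltW (k_lt0 _ _ _)) ?(ltW t_gt0)//.
  rewrite subr_le0 /g mulrAC ler_pdivlMr// ltW//.
  exact: strictly_convex_chord.
pose fa (t : R) := T t * exponential_pdf a t.
pose fb (t : R) := T t * exponential_pdf b t.
pose ia (t : R) := t * exponential_pdf a t.
pose ib (t : R) := t * exponential_pdf b t.
have hE : h = fun t => (a * fa t - b * fb t) - g * (a * ia t - b * ib t).
  by apply/funext => t; rewrite /h /k /fa /fb /ia /ib; ring.
have mI : measurable (`[0%R, +oo[%classic : set (measurableTypeR R)) by [].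
have iZ c (f : R -> R) : lebesgue_measure.-integrable `[0, +oo[ (EFin \o f) ->
    lebesgue_measure.-integrable `[0, +oo[ (EFin \o (fun t => c * f t)).
  by move=> fi; exact: (integrableZl mI c fi).
have iB (f1 f2 : R -> R) : lebesgue_measure.-integrable `[0, +oo[ (EFin \o f1) ->
    lebesgue_measure.-integrable `[0, +oo[ (EFin \o f2) ->
    lebesgue_measure.-integrable `[0, +oo[ (EFin \o (fun t => f1 t - f2 t)).
  by move=> fi1 fi2; exact: (integrableB mI fi1 fi2).
have iia := integrable_exponential_mean a0.
have iib := integrable_exponential_mean b0.
have iT : lebesgue_measure.-integrable `[0, +oo[
    (EFin \o (fun t => a * fa t - b * fb t)) by apply: iB; exact: iZ.
have ii : lebesgue_measure.-integrable `[0, +oo[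
    (EFin \o (fun t => a * ia t - b * ib t)) by apply: iB; exact: iZ.
(* [h] is strictly positive to the right of [t0], so any interval of positive length there makes the
   integral strictly positive. *)
have itv_gt0 : (0 < @lebesgue_measure R `]t0, (t0 + 1)%R])%E.
  by rewrite lebesgue_measure_itv/= lte_fin ltrDl ltr01 -EFinB addrC addKr lte_fin.
have : 0 < \int[lebesgue_measure]_(t in `[0, +oo[) h t.
  apply: (Rintegral_gt0 (mu := lebesgue_measure) (A := `]t0, t0 + 1]%classic)) => //.
  - by rewrite hE; apply: iB => //; exact: iZ.
  - by apply: subset_itv; rewrite bnd_simp// ltW.
  - by move=> t; rewrite /= in_itv/= => /andP[t0t _]; rewrite gt_eqF// h_gt0.
rewrite hE RintegralB//; last exact: iZ.
rewrite RintegralZl// !RintegralB//; try exact: iZ.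
rewrite !RintegralZl// -!/(idle_expectation _ _) !idle_expectation_id//.
(* The rate times the mean idle time is 1 for both rates, so the chord terms cancel. *)
by rewrite !divff ?gt_eqF// subrr mulr0 subr0 subr_gt0.
Qed.

Lemma throughput_at_decreasing (R : realType) (lam mu : R) (T : R -> R) (p q : R) :
  0 < lam -> utilization lam mu < 1 ->
  strictly_convex_on_nonneg T -> T 0 = 0 -> finite_idle_output lam T ->
  0 <= p -> p < q -> q <= 1 ->
  throughput_at lam mu T q < throughput_at lam mu T p.
Proof.
move=> lam0 rho1 cT T0 fT p0 pq q1.
have rate_gt0 r : 0 <= r -> 0 < batch_rate lam r.
  by move=> r0; rewrite /batch_rate divr_gt0// mulr_gt0// ltr_pwDl.
(* The mean cycle length [E[I] + E[B]] is the inverse of [batch_rate * (1 - rho)], so the throughput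
   is a constant multiple of [batch_rate * E[T(I)]], and the batch rate grows with the splitting
   probability. *)
have tE r : 0 <= r -> throughput_at lam mu T r =
    (batch_rate lam r * idle_expectation (batch_rate lam r) T) *
    (1 - utilization lam mu).
  move=> r0; have := rate_gt0 _ r0.
  rewrite /throughput_at /mean_busy_period; set L := batch_rate lam r => L0.
  rewrite idle_expectation_id//; field.
  by rewrite subrK oner_eq0 !gt_eqF// subr_gt0.
have q0 : 0 <= q := ltW (le_lt_trans p0 pq).
have p1 : p <= 1 := ltW (lt_le_trans pq q1).
rewrite !tE// ltr_pM2r ?subr_gt0//; apply: idle_output_decreasing => //.
- exact: rate_gt0.
- by rewrite /batch_rate ltr_pM2r// ltr_pM2l// ltrD2l.
- by apply: fT; rewrite p0.
- by apply: fT; rewrite q0.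
Qed.

(** * Splitting benefit *)

Lemma c1_gt0 (R : realType) (lam mu : R) :
  0 < lam -> utilization lam mu < 1 -> 0 < c1 lam mu.
Proof. by move=> lam0 rho1; rewrite /c1 divr_gt0// mulr_gt0// subr_gt0. Qed.

Lemma measurable_splitting_benefit (R : realType) (lam mu : R) :
  measurable_fun setT (fun x : R * R => splitting_benefit lam mu x.1 x.2).
Proof.
apply: measurable_funD; apply: measurable_funM => //.
- exact: measurable_funM.
- exact: measurable_funD.
Qed.

(* For each fixed [x1 >= 0] the benefit is affine in [x2] with slope
   [c1 * x1 + c2 > 0], so the sections of its level sets are singletons. *)
Lemma splitting_benefit_null d (Omega : measurableType d) (R : realType)
    (P : probability Omega R) (lam mu : R) (X1 X2 : {RV P >-> R}) (s : R) :
  0 < lam -> utilization lam mu < 1 -> iid_exponential mu X1 X2 ->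
  P [set om | splitting_benefit lam mu (X1 om) (X2 om) = s] = 0%E.
Proof.
move=> lam0 rho1 [X_ge0 X1E X2E indep].
pose X om := (X1 om, X2 om).
have mX : measurable_fun setT X by exact: measurable_fun_pair.
pose A := [set x : R * R | 0 <= x.1 /\ splitting_benefit lam mu x.1 x.2 = s].
(* The constraint [0 <= x.1] in [A] excludes the values of [x.1] at which the slope could fail to be
   positive; it leaves the event unchanged because [X1] is nonnegative surely. *)
have mA : measurable A.
  rewrite (_ : A = fst @^-1` `[0, +oo[ `&`
      (fun x => splitting_benefit lam mu x.1 x.2) @^-1` [set s]); last first.
    by apply/seteqP; split => x /=; rewrite in_itv/= andbT.
  apply: measurableI; rewrite -[X in measurable X]setTI.
    exact: measurable_fst.
  exact: measurable_splitting_benefit.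
have <- : X @^-1` A = [set om | splitting_benefit lam mu (X1 om) (X2 om) = s].
  by apply/seteqP; split => om /=; [case|move=> ?; split=> //; case: (X_ge0 om)].
pose PX := measure_function_pushforward__canonical__measure_function_Measure P mX.
rewrite -[LHS]/(PX A).
(* By independence the joint law is the product of the marginals, so [A] is null once its sections
   are null for the law of [X2]. *)
rewrite -(product_measure_unique (m1 := distribution P X1) (m2 := distribution P X2))//.
rewrite /product_measure1 integral0_eq// => x _ /=.
have [x0|x0] := leP 0 x; last first.
  rewrite (_ : xsection A x = set0) ?measure0//.
  by apply/seteqP; split => y //=; rewrite /xsection/= inE => -[]/=; rewrite leNgt x0.
have slope_gt0 : 0 < c1 lam mu * x + c2.
  by rewrite ltr_wpDl ?divr_gt0// mulr_ge0// ltW// c1_gt0.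
apply: (@subset_measure0 _ _ _ (distribution P X2) _
    [set (s - c2 * x) / (c1 lam mu * x + c2)]) => //.
- exact: measurable_xsection.
- move=> y; rewrite /xsection/= inE => -[_ /= <-].
  by rewrite /splitting_benefit; field; rewrite gt_eqF.
- by apply: etrans (X2E _ (measurable_set1 _)) _; exact: integral_set1.
Qed.

(** Without atoms the cdf is continuous, so it takes the value [1 - p]; the point is found as the
    supremum of the set where the cdf is below that value. *)
Lemma atomless_quantile d (Omega : measurableType d) (R : realType)
    (P : probability Omega R) (W : {RV P >-> R}) (p : R) :
  (forall s, P [set om | W om = s] = 0%E) -> 0 < p < 1 ->
  exists t : R, P [set om | t < W om] = p%:E.
Proof.
move=> W0 /andP[p0 p1].
suff [t Ft] : exists t : R, cdf W t = (1 - p)%:E.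
  exists t; transitivity (ccdf W t); last first.
    by rewrite ccdf_1_cdf Ft -EFinB opprB addrC subrK.
  by congr (P _); apply/seteqP; split => om /=; rewrite in_itv/= andbT.
set q := 1 - p.
pose S := [set t : R | (cdf W t < q%:E)%E].
have S_le t u : S t -> (q%:E <= cdf W u)%E -> t <= u.
  move=> St Fu; rewrite leNgt; apply/negP => ut; move: St; apply/negP.
  rewrite -leNgt (le_trans Fu)//; apply: cdf_nondecreasing; exact: ltW.
have [a Sa] : exists a, S a.
  apply: contrapT => /forallNP nS.
  suff : (q%:E <= 0)%E by rewrite lee_fin /q leNgt subr_gt0 p1.
  apply: cvge_ge (cvg_cdfNy0 W); apply: nearW => t.
  by rewrite leNgt; apply/negP; exact: nS.
have [b Fb] : exists b : R, (q%:E <= cdf W b)%E.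
  apply: contrapT => /forallNP nF.
  suff : (1 <= q%:E)%E by rewrite lee_fin /q leNgt gtrBl p0.
  apply: cvge_le (cvg_cdfy1 W); apply: nearW => t.
  by have /negP := nF t; rewrite -ltNge => /ltW.
have supS : has_sup S.
  by split; [exists a|exists b => t St; exact: S_le St Fb].
(* The bound [<= q] comes from the left: the events [W <= tau - 1/(n+1)] increase to [W < tau],
   which has the probability of [W <= tau] because [tau] is not an atom. The bound [>= q] comes from
   right continuity, since no point above [tau] is in [S]. *)
pose tau := sup S; exists tau; apply/eqP; rewrite eq_le; apply/andP; split.
  pose F n := W @^-1` `]-oo, tau - n.+1%:R^-1].
  have mF n : measurable (F n).
    by rewrite -[F n]setTI; apply: (measurable_funPT W).
  have cvF : P \o F @ \oo --> P (\bigcup_n F n).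
    apply: nondecreasing_cvg_mu => //; first exact: bigcup_measurable.
    move=> m n mn; apply/subsetPset => om; rewrite /F/= !in_itv/= => /le_trans; apply.
    by rewrite lerD2l lerN2 lef_pV2 ?posrE// ler_nat.
  have -> : cdf W tau = P (\bigcup_n F n).
    have mB : measurable [set om | W om = tau].
      rewrite -[X in measurable X]setTI.
      exact: (measurable_funPT W measurableT _ (measurable_set1 tau)).
    rewrite -(measureU0 (bigcupT_measurable F mF) mB (W0 tau)).
    congr (P _); apply/seteqP; split => om /=.
      rewrite in_itv/= le_eqVlt => /predU1P[->|Wtau]; [by right|left].
      have [n nW] := ltr_add_invr Wtau.
      by exists n => //; rewrite /F/= in_itv/= lerBrDr ltW.
    move=> [[n _]|->]; rewrite /F/= !in_itv/= ?lexx// => /le_trans; apply.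
    by rewrite gerBl invr_ge0.
  apply: cvge_le cvF; near=> n => /=.
  (* Were the cdf already above [q] at [tau - 1/(n+1)], that point would be an upper bound of [S]
     below its supremum. *)
  rewrite leNgt; apply/negP => qF.
  have : tau - n.+1%:R^-1 < tau by rewrite ltrBlDr ltrDl invr_gt0.
  apply/negP; rewrite -leNgt; apply: ge_sup; first by exists a.
  by move=> t St; apply: S_le St (ltW qF).
have rc := @cdf_right_continuous _ _ _ _ W tau.
apply: cvge_ge rc; near=> u.
have tu : tau < u by near: u; exact: nbhs_right_gt.
rewrite leNgt; apply/negP => Su.
by move: tu; apply/negP; rewrite -leNgt; apply: ub_le_sup => //; case: supS.
Unshelve. all: by end_near. Qed.

(** * Routing policies *)

Lemma fine_expectation d (Omega : measurableType d) (R : realType)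
    (P : probability Omega R) (f : Omega -> R) :
  fine 'E_P[f] = \int[P]_om f om.
Proof. by rewrite unlock. Qed.

Section routing.
Context (R : realType) (d : measure_display) (Omega : measurableType d).
Context (P : probability Omega R) (lam mu : R).
Context (lam_gt0 : 0 < lam) (mu_gt0 : 0 < mu) (rho_lt1 : utilization lam mu < 1).
Context (X1 X2 : {RV P >-> R}) (X_iid : iid_exponential mu X1 X2).

Let X om := (X1 om, X2 om).
Let w om := splitting_benefit lam mu (X1 om) (X2 om).

Local Notation integrableR f := (P.-integrable [set: Omega] (EFin \o f)).

(** * Integrability of service times and policies *)

Lemma service_time1_ge0 om : 0 <= X1 om.
Proof. by case: X_iid => /(_ om)[]. Qed.

Lemma service_time2_ge0 om : 0 <= X2 om.
Proof. by case: X_iid => /(_ om)[]. Qed.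

Hint Resolve service_time1_ge0 service_time2_ge0 : core.

Lemma splitting_benefit_ge0 om : 0 <= w om.
Proof.
have c2_ge0 : 0 <= c2 :> R by rewrite divr_ge0.
apply: addr_ge0; apply: mulr_ge0; rewrite ?addr_ge0//.
by apply: mulr_ge0 => //; exact/ltW/c1_gt0.
Qed.

Lemma measurable_benefit : measurable_fun setT w.
Proof.
have mX : measurable_fun setT X by exact: measurable_fun_pair.
exact: measurableT_comp (measurable_splitting_benefit lam mu) mX.
Qed.

Lemma integrable_sqr1 : integrableR (fun om => X1 om ^+ 2).
Proof. by case: X_iid => _ ? _ _; exact: (integrable_exponential_sqr mu_gt0). Qed.

Lemma integrable_sqr2 : integrableR (fun om => X2 om ^+ 2).
Proof. by case: X_iid => _ _ ? _; exact: (integrable_exponential_sqr mu_gt0). Qed.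

Lemma integrableRD (f g : Omega -> R) : integrableR f -> integrableR g ->
  integrableR (fun om => f om + g om).
Proof. by move=> fi gi; exact: (integrableD measurableT fi gi). Qed.

Lemma integrableRB (f g : Omega -> R) : integrableR f -> integrableR g ->
  integrableR (fun om => f om - g om).
Proof. by move=> fi gi; exact: (integrableB measurableT fi gi). Qed.

Lemma integrableRZ (k : R) (f : Omega -> R) : integrableR f ->
  integrableR (fun om => k * f om).
Proof. by move=> fi; exact: (integrableZl measurableT k fi). Qed.

Lemma le_integrableR (f g : Omega -> R) : measurable_fun setT f ->
  (forall om, `|f om| <= g om) -> integrableR g -> integrableR f.
Proof.
move=> mf fg gi; apply: le_integrable gi => //; first exact/measurable_EFinP.
by move=> om _; rewrite /= lee_fin (le_trans (fg om))// ler_norm.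
Qed.

Lemma integrableR_cst (k : R) : integrableR (fun=> k).
Proof. exact: finite_measure_integrable_cst. Qed.

Lemma integrable_sum : integrableR (fun om => X1 om + X2 om).
Proof.
apply: (@le_integrableR _ (fun om => (X1 om ^+ 2 + X2 om ^+ 2) + 1)).
- exact: measurable_funD.
- move=> om; rewrite ger0_norm ?addr_ge0//.
  have := sqr_ge0 (X1 om - 2^-1); have := sqr_ge0 (X2 om - 2^-1).
  by rewrite !sqrrB; lra.
- apply: integrableRD; last exact: integrableR_cst.
  by apply: integrableRD; [exact: integrable_sqr1|exact: integrable_sqr2].
Qed.

Lemma integrable_prod : integrableR (fun om => X1 om * X2 om).
Proof.
apply: (@le_integrableR _ (fun om => X1 om ^+ 2 + X2 om ^+ 2)).
- exact: measurable_funM.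
- move=> om; have p0 := mulr_ge0 (service_time1_ge0 om) (service_time2_ge0 om).
  by rewrite ger0_norm//; have := sqr_ge0 (X1 om - X2 om); rewrite sqrrB; lra.
- by apply: integrableRD; [exact: integrable_sqr1|exact: integrable_sqr2].
Qed.

Lemma integrable_benefit : integrableR w.
Proof.
have -> : w = fun om => c1 lam mu * (X1 om * X2 om) + c2 * (X1 om + X2 om).
  by apply/funext => om; rewrite /w /splitting_benefit mulrA.
by apply: integrableRD; apply: integrableRZ;
  [exact: integrable_prod|exact: integrable_sum].
Qed.

Lemma policy_01 (r : R * R -> R) om : routing_policy r -> 0 <= r (X om) <= 1.
Proof. by move=> [_]; apply; split => /=. Qed.

(** A policy is measurable only on the quadrant, which suffices because the service times lie there
    surely. *)
Lemma measurable_policy (r : R * R -> R) : routing_policy r ->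
  measurable_fun setT (r \o X).
Proof.
move=> [mr _]; apply: measurable_comp mr _ => //.
- rewrite (_ : nonneg_quadrant = `[0, +oo[ `*` `[0, +oo[).
    exact: measurableX.
  by apply/seteqP; split => x /=; rewrite /nonneg_quadrant/= !in_itv/= !andbT.
- by move=> _ [om _ <-]; split => /=.
- exact: measurable_fun_pair.
Qed.

Lemma integrable_policyM (r : R * R -> R) (f : Omega -> R) :
  routing_policy r -> (forall om, 0 <= f om) -> integrableR f ->
  integrableR (fun om => r (X om) * f om).
Proof.
move=> rP f0 fi; apply: (@le_integrableR _ f) => //.
  apply: measurable_funM; first exact: measurable_policy.
  by apply/measurable_EFinP; exact: measurable_int fi.
move=> om; have /andP[r0 r1] := policy_01 om rP.
by rewrite ger0_norm ?mulr_ge0// ler_piMl.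
Qed.

Lemma integrable_policy (r : R * R -> R) : routing_policy r ->
  integrableR (r \o X).
Proof.
move=> rP; apply: (@le_integrableR _ (fun=> 1)); last exact: integrableR_cst.
  exact: measurable_policy.
by move=> om; have /andP[r0 r1] := policy_01 om rP; rewrite ger0_norm.
Qed.

(** * Splitting probability and mean wait *)

Lemma splitting_probabilityE (r : R * R -> R) :
  splitting_probability P X1 X2 r = \int[P]_om r (X om).
Proof. exact: fine_expectation. Qed.

Lemma splitting_probability_01 (r : R * R -> R) : routing_policy r ->
  0 <= splitting_probability P X1 X2 r <= 1.
Proof.
move=> rP; rewrite splitting_probabilityE Rintegral_ge0/=; last first.
  by move=> om _; case/andP: (policy_01 om rP).
have <- : \int[P]_(om in setT) (fun=> 1) om = 1 :> R.
  by rewrite Rintegral_cst// mul1r; exact: (congr1 (@fine R) (probability_setT P)).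
apply: le_Rintegral => //.
- exact: integrable_policy.
- exact: integrableR_cst.
- by move=> om _; case/andP: (policy_01 om rP).
Qed.

(** Splitting replaces [(x1 + x2) ^+ 2] by [x1 ^+ 2 + x2 ^+ 2], saving [2 * x1 * x2], and removes
    the within-batch delay. After scaling, the two savings are the two terms of [w]. [C] is the mean
    wait when every pair is bunched. *)
Lemma mean_waitE : exists C : R, forall r, routing_policy r ->
  mean_wait lam mu P X1 X2 r = C - \int[P]_om (r (X om) * w om).
Proof.
pose S om := (X1 om + X2 om) ^+ 2; pose L om := X1 om + X2 om.
have SI : integrableR S.
  have -> : S = fun om => (X1 om ^+ 2 + X2 om ^+ 2) + 2 * (X1 om * X2 om).
    by apply/funext => om; rewrite /S; ring.
  apply: integrableRD; last by apply: integrableRZ; exact: integrable_prod.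
  by apply: integrableRD; [exact: integrable_sqr1|exact: integrable_sqr2].
pose k := lam / 2 / (2 * (1 - utilization lam mu)).
exists (k * \int[P]_om S om + 1 / 4 * \int[P]_om L om) => r rP.
rewrite /mean_wait /rate_batch_second_moment !fine_expectation.
pose r12 om := r (X om) * (X1 om * X2 om); pose rL om := r (X om) * L om.
have r12I : integrableR r12.
  apply: integrable_policyM => //; last exact: integrable_prod.
  by move=> om; rewrite mulr_ge0.
have rLI : integrableR rL.
  apply: integrable_policyM => //; last exact: integrable_sum.
  by move=> om; rewrite addr_ge0.
have -> : \int[P]_om ((1 - r (X1 om, X2 om)) * (X1 om + X2 om) ^+ 2 +
    r (X1 om, X2 om) * (X1 om ^+ 2 + X2 om ^+ 2)) =
    \int[P]_om S om - 2 * \int[P]_om r12 om.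
  rewrite -RintegralZl// -RintegralB//; last exact: integrableRZ.
  by apply: eq_Rintegral => om _; rewrite /S /r12 /X; ring.
have -> : \int[P]_om ((1 - r (X1 om, X2 om)) * (X1 om + X2 om)) =
    \int[P]_om L om - \int[P]_om rL om.
  rewrite -RintegralB//; last exact: integrable_sum.
  by apply: eq_Rintegral => om _; rewrite /rL /L /X; ring.
have -> : \int[P]_om (r (X om) * w om) =
    c1 lam mu * \int[P]_om r12 om + c2 * \int[P]_om rL om.
  rewrite -!RintegralZl// -RintegralD//; try exact: integrableRZ.
  by apply: eq_Rintegral => om _; rewrite /w /splitting_benefit /rL /r12 /L; ring.
rewrite /k /c1 /c2; field.
by rewrite gt_eqF// subr_gt0.
Qed.

(** * Threshold policies *)

Lemma benefit_null s : P [set om | w om = s] = 0%E.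
Proof. exact: splitting_benefit_null. Qed.

Lemma measurable_benefit_gt (tau : \bar R) :
  measurable [set om | (tau < (w om)%:E)%E].
Proof.
rewrite -[X in measurable X]setTI; apply: measurable_lte => //.
by apply/measurable_EFinP; exact: measurable_benefit.
Qed.

Lemma ae_benefit_neq (tau : \bar R) : {ae P, forall om, (w om)%:E != tau}.
Proof.
(* For infinite [tau] nothing has to be covered; [fine tau] is then 0 and the witness is still a
   null set. *)
exists [set om | w om = fine tau]; split.
- rewrite -[X in measurable X]setTI.
  exact: (measurable_benefit measurableT (measurable_set1 (fine tau))).
- exact: benefit_null.
- by move=> om /= /negP; rewrite negbK => /eqP <-.
Qed.

(** Off the null boundary [w = tau], the policy is the indicator of [tau < w]. *)
Lemma threshold_splitting_probability (p : R) r :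
  threshold_policy lam mu P X1 X2 p r -> splitting_probability P X1 X2 r = p.
Proof.
move=> [rP [tau [Ptau _ _ rE]]]; rewrite splitting_probabilityE.
have mtau := measurable_benefit_gt tau.
rewrite (@ae_eq_Rintegral _ _ _ P _ _ (\1_[set om | (tau < (w om)%:E)%E]))//.
- by rewrite /Rintegral integral_indic// setIT; exact: (congr1 (@fine R) Ptau).
- exact: measurable_policy.
- apply: filterS (ae_benefit_neq tau) => om wtau _.
  have [r1 r0] := rE _ _ (service_time1_ge0 om) (service_time2_ge0 om).
  rewrite indicE; case: (ltgtP tau (w om)%:E) => [tw|wt|/eqP].
  - by rewrite mem_set// r1.
  - by rewrite memNset ?r0//= => tw; move: (lt_trans tw wt); rewrite ltxx.
  - by rewrite eq_sym (negbTE wtau).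
Qed.

(** Replaces the extended threshold by a real one, so that [t] can enter integrals. Its sign
    matters: the comparison of policies multiplies [t] by a nonnegative gap between splitting
    probabilities. *)
Lemma threshold_cases (p : R) r : 0 <= p <= 1 ->
  threshold_policy lam mu P X1 X2 p r ->
  (p = 0 /\ forall om, r (X om) = 0) \/
  exists2 t : R, 0 <= t &
    forall om, (t < w om -> r (X om) = 1) /\ (w om < t -> r (X om) = 0).
Proof.
move=> p01 [rP [tau [Ptau tau1 tau0 rE]]].
(* A threshold below all values of [w] forces [p = 1], for which the convention is [tau = 0]. This
   rules out negative thresholds, including [-oo]. *)
have all_gt : (forall om, (tau < (w om)%:E)%E) -> tau = 0%E.
  move=> tauw; apply: tau1; apply: EFin_inj; rewrite -Ptau -(probability_setT P).
  by congr (P _); apply/seteqP; split => om // _; exact: tauw.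
have rX om := rE _ _ (service_time1_ge0 om) (service_time2_ge0 om).
case: tau => [t| |] in Ptau tau1 tau0 rE all_gt rX *.
- right; exists t => [|om]; last first.
    by have [r1 r0] := rX om; rewrite -!lte_fin.
  rewrite leNgt; apply/negP => t0.
  suff : t%:E = 0%E by case=> t0'; rewrite t0' ltxx in t0.
  by apply: all_gt => om; rewrite lte_fin (lt_le_trans t0)// splitting_benefit_ge0.
- left; split; last by move=> om; apply: (rX om).2; rewrite ltry.
  apply: EFin_inj; rewrite -Ptau -[RHS](measure0 P); congr (P _).
  by apply/seteqP; split => om //=; rewrite ltNge leey.
- by have : -oo%E = 0%E :> \bar R by apply: all_gt => om; rewrite ltNyr.
Qed.

(* Neyman-Pearson: [(r - r') * (w - t)] is pointwise nonnegative when [r] has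
   threshold [t], and it is a.e. nonzero wherever the two policies differ. *)
Lemma threshold_benefit_max (p : R) r r' : 0 <= p <= 1 ->
  threshold_policy lam mu P X1 X2 p r -> routing_policy r' ->
  splitting_probability P X1 X2 r' <= p ->
  \int[P]_om (r' (X om) * w om) <= \int[P]_om (r (X om) * w om) /\
  (splitting_probability P X1 X2 r' < p ->
   \int[P]_om (r' (X om) * w om) < \int[P]_om (r (X om) * w om)).
Proof.
move=> p01 rT r'P; have rP : routing_policy r by case: rT.
have rp := threshold_splitting_probability rT.
have ir := integrable_policy rP; have ir' := integrable_policy r'P.
have irw := integrable_policyM rP splitting_benefit_ge0 integrable_benefit.
have ir'w := integrable_policyM r'P splitting_benefit_ge0 integrable_benefit.
have r'_ge0 om : [set: Omega] om -> 0 <= r' (X om).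
  by case/andP: (policy_01 om r'P).
have [[p0 r0]|[t t0 rX]] := threshold_cases p01 rT.
  (* With [p = 0] the competitor has integral 0, hence vanishes a.e., and both benefits are 0. *)
  rewrite p0 splitting_probabilityE => r'_le0; split; last first.
    by rewrite ltNge Rintegral_ge0.
  have r'_eq0 : \int[P]_om r' (X om) = 0.
    by apply/eqP; rewrite eq_le r'_le0 Rintegral_ge0.
  rewrite le_eqVlt; apply/orP; left; apply/eqP.
  apply: ae_eq_Rintegral => //.
  - by apply/measurable_EFinP; exact: measurable_int ir'w.
  - by apply/measurable_EFinP; exact: measurable_int irw.
  apply: filterS (ae_eq_Rintegral0 measurableT ir' r'_ge0 r'_eq0) => om /= r'0 _.
  by case: (r'0 I) => ->; rewrite r0 !mul0r.
pose h om := (r (X om) * w om - r' (X om) * w om) - t * (r (X om) - r' (X om)).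
have ih : integrableR h.
  by apply: integrableRB; [|apply: integrableRZ]; exact: integrableRB.
have hE om : h om = (r (X om) - r' (X om)) * (w om - t) by rewrite /h; ring.
have h_ge0 om : [set: Omega] om -> 0 <= h om.
  move=> _; have [r1 r0] := rX om; have /andP[r'0 r'1] := policy_01 om r'P.
  rewrite hE; case: (ltgtP (w om) t) => [wt|tw|->].
  - by rewrite r0// mulr_le0// ?sub0r ?oppr_le0 ?subr_le0// ltW.
  - by rewrite r1// mulr_ge0// subr_ge0// ltW.
  - by rewrite subrr mulr0.
have int_h : \int[P]_om h om =
    (\int[P]_om (r (X om) * w om) - \int[P]_om (r' (X om) * w om)) -
    t * (p - splitting_probability P X1 X2 r').
  rewrite -rp !splitting_probabilityE /h RintegralB//; last 2 first.
  - exact: integrableRB.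
  - by apply: integrableRZ; exact: integrableRB.
  by rewrite RintegralZl ?RintegralB//; exact: integrableRB.
have h0 : 0 <= \int[P]_om h om by exact: Rintegral_ge0.
move=> r'p; have tp : 0 <= t * (p - splitting_probability P X1 X2 r').
  by rewrite mulr_ge0// subr_ge0.
split; first by move: h0; rewrite int_h; lra.
(* If [h] integrated to 0 it would vanish a.e.; as [w] differs from [t] a.e., the two policies would
   agree a.e. and have equal splitting probabilities. *)
move=> r'_lt; suff : 0 < \int[P]_om h om by rewrite int_h; lra.
rewrite lt_neqAle h0 andbT eq_sym; apply/eqP => h_eq0.
move: r'_lt; rewrite -rp !splitting_probabilityE => /lt_eqF/eqP; apply.
apply: ae_eq_Rintegral => //; try exact: measurable_policy.
have ae0 := ae_eq_Rintegral0 measurableT ih h_ge0 h_eq0.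
apply: filterS2 ae0 (ae_benefit_neq t%:E) => om /= h_om wt _.
move: (h_om I) => [/eqP]; rewrite hE mulf_eq0 !subr_eq0 => /orP[/eqP//|/eqP wE].
by rewrite wE eqxx in wt.
Qed.

Lemma threshold_policy_exists (p : R) : 0 <= p <= 1 ->
  exists r, threshold_policy lam mu P X1 X2 p r.
Proof.
move=> /andP[p0 p1].
suff [tau [Ptau tau1 tau0]] : exists tau : \bar R,
    [/\ P [set om | (tau < (w om)%:E)%E] = p%:E, p = 1 -> tau = 0%E &
        p = 0 -> tau = +oo%E].
  exists (fun x => if (tau < (splitting_benefit lam mu x.1 x.2)%:E)%E then 1 else 0).
  split; last first.
    exists tau; split => // x1 x2 _ _ /=; split=> [->//|wt].
    by rewrite ltNge ltW.
  split=> [|x _]; last by case: ifP; rewrite ?lexx ?ler01.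
  apply: measurable_funTS; apply: measurable_fun_ifT => //.
  apply: measurable_fun_lte => //.
  by apply/measurable_EFinP; exact: measurable_splitting_benefit.
have [->|p_neq0] := eqVneq p 0.
  exists +oo%E; split => //; last by move/eqP; rewrite eq_sym oner_eq0.
  rewrite -[RHS](measure0 P); congr (P _).
  by apply/seteqP; split => om //=; rewrite ltNge leey.
have [->|p_neq1] := eqVneq p 1.
  (* The benefit is nonnegative and has no atom at 0, so it exceeds 0 almost surely. *)
  exists 0%E; split => //; last by move/eqP; rewrite oner_eq0.
  rewrite -(probability_setT P) -[in RHS](setvU [set om | w om = 0]).
  rewrite measureU0.
  - congr (P _); apply/seteqP; split => om /=; rewrite lte_fin.
      by move=> /[swap] ->; rewrite ltxx.
    by move/eqP => w0; rewrite lt_neqAle eq_sym w0 splitting_benefit_ge0.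
  - apply: measurableC; rewrite -[X in measurable X]setTI.
    exact: (measurable_benefit measurableT (measurable_set1 0)).
  - rewrite -[X in measurable X]setTI.
    exact: (measurable_benefit measurableT (measurable_set1 0)).
  - exact: benefit_null.
pose W : {RV P >-> R} := HB.pack w
  (isMeasurableFun.Build _ _ _ _ _ measurable_benefit).
have [||t Pt] := @atomless_quantile _ _ _ P W p.
- exact: benefit_null.
- by rewrite !lt_neqAle p0 p1 p_neq1 eq_sym p_neq0.
- exists t%:E; split => //; first by move/eqP; rewrite (negbTE p_neq1).
  by move/eqP; rewrite (negbTE p_neq0).
Qed.

End routing.

(** * The Pareto frontier *)

Theorem theorem1 (R : realType) (d : measure_display)
    (Omega : measurableType d) (P : probability Omega R)
    (lam mu : R) (lam_gt0 : 0 < lam) (mu_gt0 : 0 < mu)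
    (rho_lt1 : utilization lam mu < 1)
    (X1 X2 : {RV P >-> R}) (X_iid : iid_exponential mu X1 X2)
    (T : R -> R) (T_diff : differentiable_on_nonneg T)
    (T_incr : increasing_on_nonneg T) (T0 : T 0 = 0)
    (T_convex : strictly_convex_on_nonneg T)
    (T_finite : finite_idle_output lam T) :
  [/\ forall p : R, 0 <= p <= 1 ->
        exists r, threshold_policy lam mu P X1 X2 p r,
      forall (p : R) r, 0 <= p <= 1 ->
        threshold_policy lam mu P X1 X2 p r ->
        pareto_optimal lam mu P X1 X2 T r &
      forall r, pareto_optimal lam mu P X1 X2 T r ->
        exists (p : R) r', [/\ 0 <= p <= 1,
          threshold_policy lam mu P X1 X2 p r',
          mean_wait lam mu P X1 X2 r' = mean_wait lam mu P X1 X2 r &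
          throughput lam mu P X1 X2 T r' = throughput lam mu P X1 X2 T r]].
Proof.
have [C waitE] := mean_waitE mu_gt0 rho_lt1 X_iid.
have thr_decr p q := @throughput_at_decreasing _ _ _ _ p q lam_gt0 rho_lt1
  T_convex T0 T_finite.
have sp01 := splitting_probability_01 X_iid.
have wait_min p r r' := @threshold_benefit_max _ _ _ _ _ _ lam_gt0 mu_gt0 rho_lt1
  _ _ X_iid p r r'.
split=> [p p01|p r p01 rT|r [rP r_opt]].
- exact: threshold_policy_exists.
- have rP : routing_policy r by case: rT.
  have rp := threshold_splitting_probability lam_gt0 rho_lt1 X_iid rT.
  split => // -[r' [r'P]]; rewrite /throughput rp !waitE//.
  have /andP[p'0 p'1] := sp01 _ r'P; have /andP[p0 p1] := p01.
  move: (wait_min _ _ _ p01 rT r'P).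
  (* A competitor that splits less has strictly larger wait, one that splits more has strictly
     smaller throughput, and one that splits equally often ties in throughput without a smaller
     wait. *)
  case: (ltgtP (splitting_probability P X1 X2 r') p) => [lt_p'p|lt_pp'|->].
  + by move=> [//|_ /(_ isT) ?]; case=> -[? ?]; lra.
  + by move=> _; have := thr_decr _ _ p0 lt_pp' p'1; case=> -[? ?]; lra.
  + by move=> [//|? _]; case=> -[? ?]; lra.
(* The threshold policy with the splitting probability of [r] has the same throughput and no larger
   wait; a strictly smaller wait would contradict the optimality of [r]. *)
- set p := splitting_probability P X1 X2 r.
  have p01 : 0 <= p <= 1 by exact: sp01.
  have [r' r'T] := threshold_policy_exists lam_gt0 rho_lt1 X_iid p01.
  have r'P : routing_policy r' by case: r'T.
  have r'p := threshold_splitting_probability lam_gt0 rho_lt1 X_iid r'T.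
  have thrE : throughput lam mu P X1 X2 T r' = throughput lam mu P X1 X2 T r.
    by rewrite /throughput r'p.
  exists p, r'; split => //.
  have [le_rr' _] := wait_min _ _ _ p01 r'T rP (lexx _).
  apply/eqP; rewrite eq_le; apply/andP; split; first by rewrite !waitE// lerD2l lerN2.
  rewrite leNgt; apply/negP => lt_wait; apply: r_opt; exists r'; split => //.
  by left; rewrite thrE.
Qed.
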